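(* Let $n$ be a positive integer. For every square matrix $A\in\mathbb{C}^{n\times n}$ with Moore-Penrose inverse $A^\dag$ and Drazin inverse $A^d$, we have $$\|AA^\dag-AA^d\|_F\le \sqrt{2}\cdot\sqrt{\|m(AA^d)-AA^d\|_F^2+\mathrm{rank}(A)-\mathrm{rank}(A^d)},$$ where $m(AA^d)$ is the matched projection of the idempotent $AA^d$. Moreover, equality occurs if and only if $A^d=A^\dag$.
   Context: An idempotent is a matrix $Q$ with $Q^2=Q$; a projection is a Hermitian idempotent. $A^d$ denotes the Drazin inverse of a square matrix $A$: the unique matrix $X$ with $AX=XA$, $XAX=X$ and $A^{k+1}X=A^k$ for some integer $k\ge 0$; $AA^d$ is an idempotent. $\|\cdot\|_F$ is the Frobenius norm, $A^*$ the conjugate transpose, and $|B|=(B^*B)^{1/2}$ the positive semi-definite square root, so $|Q^*|=(QQ^* )^{1/2}$. For an idempotent $Q\in\mathbb{C}^{n\times n}$ the matched projection is $$m(Q)=\tfrac12\big(|Q^*|+Q^*\big)\,|Q^*|^\dag\,\big(|Q^*|+I_n\big)^{-1}\big(|Q^*|+Q\big),$$ which is known to be a projection. *)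

(* Defs.v *)
From HB Require Import structures.
From mathcomp Require Import all_boot all_order all_algebra.
From mathcomp Require Import all_classical all_reals.
From mathcomp Require Import complex.

Set Implicit Arguments.
Unset Strict Implicit.
Unset Printing Implicit Defensive.

Import Order.TTheory GRing.Theory Num.Theory.
Local Open Scope ring_scope.
Local Open Scope sesquilinear_scope.

Section GeneralizedInverses.
Variable C : numClosedFieldType.

Definition is_mpinv m n (A : 'M[C]_(m, n)) (X : 'M[C]_(n, m)) : Prop :=
  [/\ A *m X *m A = A, X *m A *m X = X,
      (A *m X)^t* = A *m X & (X *m A)^t* = X *m A].

(* The default value 0 of [xget] is never used here: see [mpinvP]. *)
Definition mpinv m n (A : 'M[C]_(m, n)) : 'M[C]_(n, m) :=
  xget 0 [set X | is_mpinv A X]%classic.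

Definition is_drazin n (A X : 'M[C]_n) : Prop :=
  [/\ A *m X = X *m A, X *m A *m X = X
    & exists k : nat, A ^+ k.+1 *m X = A ^+ k].

(* The default value is never used here either: see [drazinP]. *)
Definition drazin n (A : 'M[C]_n) : 'M[C]_n :=
  xget 0 [set X | is_drazin A X]%classic.

Definition psdmx n (S : 'M[C]_n) : Prop :=
  S^t* = S /\ forall x : 'cV[C]_n, 0 <= (x^t* *m S *m x) 0 0.

(* Meaningful when M is positive semi-definite: see [psd_sqrtP]. *)
Definition psd_sqrt n (M : 'M[C]_n) : 'M[C]_n :=
  xget 0 [set S | psdmx S /\ S *m S = M]%classic.

Definition absmx n (B : 'M[C]_n) : 'M[C]_n := psd_sqrt (B^t* *m B).

Definition matched_proj n (Q : 'M[C]_n) : 'M[C]_n :=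
  let T := absmx (Q^t*) in
  2%:R^-1 *: ((T + Q^t*) *m mpinv T *m invmx (T + 1%:M) *m (T + Q)).

Lemma trmxC_mul m n p (A : 'M[C]_(m, n)) (B : 'M[C]_(n, p)) :
  (A *m B)^t* = B^t* *m A^t*.
Proof. by rewrite trmx_mul map_mxM. Qed.

Lemma trmxC_inv n (A : 'M[C]_n) : (invmx A)^t* = invmx (A^t*).
Proof. by rewrite trmx_inv map_invmx. Qed.

Lemma sqnorm_ge0 n (x : 'cV[C]_n) : 0 <= (x^t* *m x) 0 0.
Proof.
rewrite mxE; apply: sumr_ge0 => i _; rewrite !mxE mulrC; exact: mul_conjC_ge0.
Qed.

Lemma sqnorm_eq0 n (x : 'cV[C]_n) : (x^t* *m x) 0 0 = 0 -> x = 0.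
Proof.
rewrite mxE => /eqP; rewrite psumr_eq0; last first.
  by move=> i _; rewrite !mxE mulrC mul_conjC_ge0.
move=> /allP x0; apply/colP => i; rewrite mxE.
by have := x0 i (mem_index_enum i); rewrite /= !mxE mulrC mul_conjC_eq0 => /eqP.
Qed.

Lemma unitmx_col n (A : 'M[C]_n) :
  (forall x : 'cV[C]_n, A *m x = 0 -> x = 0) -> A \in unitmx.
Proof.
move=> A_inj; rewrite -unitmx_tr -row_free_unit -kermx_eq0.
apply/eqP/row_matrixP => i; rewrite row0; apply: trmx_inj; rewrite trmx0.
apply: A_inj; apply: trmx_inj; rewrite trmx_mul trmxK trmx0.
by rewrite -row_mul mulmx_ker row0.
Qed.

Lemma gram_unit m n (B : 'M[C]_(m, n)) : \rank B = n -> B^t* *m B \in unitmx.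
Proof.
move=> rB; apply: unitmx_col => x Bx0.
have : ((B *m x)^t* *m (B *m x)) 0 0 = 0.
  by rewrite trmxC_mul -mulmxA (mulmxA _ B x) Bx0 mulmx0 mxE.
move=> /sqnorm_eq0 Bx; have /row_fullP [L LB] : row_full B by rewrite -col_leq_rank rB.
by rewrite -[x]mul1mx -LB -mulmxA Bx mulmx0.
Qed.

Lemma mpinv_factor m r n (B : 'M[C]_(m, r)) (D : 'M[C]_(r, n)) :
  \rank B = r -> \rank D = r -> exists X, is_mpinv (B *m D) X.
Proof.
move=> rB rD; have uB := gram_unit rB.
have uD : D *m D^t* \in unitmx.
  by rewrite -{1}[D]trmxCK; apply: gram_unit; rewrite mxrank_map mxrank_tr.
pose X := D^t* *m invmx (D *m D^t*) *m (invmx (B^t* *m B) *m B^t*).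
have AX : B *m D *m X = B *m invmx (B^t* *m B) *m B^t*.
  by rewrite /X !mulmxA -(mulmxA B D) mulmxK.
have XA : X *m (B *m D) = D^t* *m invmx (D *m D^t*) *m D.
  rewrite /X -!mulmxA (mulmxA (B^t*)) (mulmxA (invmx (B^t* *m B))).
  by rewrite mulVmx // mul1mx.
exists X; split.
- by rewrite AX -!mulmxA (mulmxA (B^t*)) (mulmxA (invmx _)) mulVmx // mul1mx.
- rewrite XA /X -!mulmxA (mulmxA D) (mulmxA (D *m _)) mulmxV // mul1mx.
  by rewrite !mulmxA.
- by rewrite AX !trmxC_mul trmxC_inv trmxC_mul trmxCK mulmxA.
- by rewrite XA !trmxC_mul trmxC_inv trmxC_mul trmxCK mulmxA.
Qed.

Lemma mpinv_exists m n (A : 'M[C]_(m, n)) : exists X, is_mpinv A X.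
Proof.
rewrite -{1}(mulmx_base A).
apply: mpinv_factor; apply/eqP.
  exact: col_base_full.
exact: row_base_free.
Qed.

Lemma mpinvP m n (A : 'M[C]_(m, n)) : is_mpinv A (mpinv A).
Proof. exact: (@xgetPex _ _ [set X | is_mpinv A X]%classic (mpinv_exists A)). Qed.

Lemma mpinv_unique m n (A : 'M[C]_(m, n)) X Y :
  is_mpinv A X -> is_mpinv A Y -> X = Y.
Proof.
move=> [X1 X2 X3 X4] [Y1 Y2 Y3 Y4].
have AXY : A *m X = A *m Y.
  rewrite -X3 -{1}Y1 -(mulmxA (A *m Y)) trmxC_mul X3 Y3.
  by rewrite mulmxA X1.
have XAY : X *m A = Y *m A.
  rewrite -X4 -{1}Y1 -!mulmxA mulmxA trmxC_mul X4 Y4.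
  by rewrite -mulmxA (mulmxA A) X1.
by rewrite -X2 XAY -mulmxA AXY mulmxA Y2.
Qed.

Lemma drazin_ring (R : pzRingType) (a y z : R) k :
    a ^+ k = y * a ^+ (k + k.+1) -> a ^+ k = a ^+ (k + k.+1) * z ->
  let x := a ^+ k * z in [/\ a * x = x * a, x * a * x = x & a ^+ k.+1 * x = a ^+ k].
Proof.
move=> ky kz x; have xE : x = y * a ^+ k by rewrite /x {1}ky -mulrA -kz.
have ax : a * x = y * a ^+ k.+1.
  rewrite /x mulrA -exprS exprSr {1}ky -!mulrA; congr (_ * _).
  by rewrite mulrA -exprSr exprS -mulrA -kz -exprS exprSr.
split; first by rewrite ax xE -mulrA -exprSr.
  by rewrite {1}xE -(mulrA y) -exprSr /x mulrA -(mulrA y) -exprD addnC -ky.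
by rewrite /x mulrA -exprD addnC -kz.
Qed.

Lemma drazin_exists n (A : 'M[C]_n) : exists X, is_drazin A X.
Proof.
have exprDm k l : A ^+ (k + l) = A ^+ k *m A ^+ l by exact: exprD.
have Pex : exists r, `[< exists k, \rank (A ^+ k) = r >].
  by exists (\rank (A ^+ 0)); apply/asboolP; exists 0%N.
case: (ex_minnP Pex) => r /asboolP[k rk] r_min.
have rkE l : (\rank (A ^+ k) <= \rank (A ^+ l))%N.
  by rewrite rk; apply: r_min; apply/asboolP; exists l.
pose N := (k + k.+1)%N.
have [Y defY] : exists Y, A ^+ k = Y *m A ^+ N.
  have sub : (A ^+ N <= A ^+ k)%MS by rewrite /N addnC exprDm submxMl.
  by apply/submxP; rewrite -(mxrank_leqif_sup sub).2 eqn_leq rkE mxrankS.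
have [Z defZ] : exists Z, A ^+ k = A ^+ N *m Z.
  have sub : ((A ^+ N)^T <= (A ^+ k)^T)%MS by rewrite /N exprDm trmx_mul submxMl.
  have /submxP[Z dZ] : ((A ^+ k)^T <= (A ^+ N)^T)%MS.
    by rewrite -(mxrank_leqif_sup sub).2 eqn_leq mxrankS // !mxrank_tr rkE.
  by exists Z^T; apply: trmx_inj; rewrite trmx_mul trmxK.
have [X1 X2 X3] := drazin_ring defY defZ.
by exists (A ^+ k *m Z); split=> //; exists k.
Qed.

Lemma drazinP n (A : 'M[C]_n) : is_drazin A (drazin A).
Proof. exact: (@xgetPex _ _ [set X | is_drazin A X]%classic (drazin_exists A)). Qed.

Lemma drazin_ring_unique (R : pzRingType) (a x y : R) k l :
    a * x = x * a -> x * a * x = x -> a ^+ k.+1 * x = a ^+ k ->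
    a * y = y * a -> y * a * y = y -> a ^+ l.+1 * y = a ^+ l -> x = y.
Proof.
have core (u v : R) i : a * u = u * a -> u * a * u = u -> a * v = v * a ->
    a ^+ i.+1 * v = a ^+ i -> a * u = a * v * (a * u) /\ a * u = a * u * (a * v).
  move=> cu uu cv iv.
  have idu m : (a * u) ^+ m.+1 = a * u.
    by elim: m => [|m IHm] //; rewrite exprS IHm mulrA -(mulrA a) -mulrA uu.
  have civ : v * a ^+ i.+1 = a ^+ i.+1 * v by apply: commrX; rewrite /GRing.comm -cv.
  have e1 : a * v * a ^+ i.+1 = a ^+ i.+1 by rewrite -mulrA civ iv -exprS.
  have e2 : a ^+ i.+1 * (a * v) = a ^+ i.+1 by rewrite cv mulrA iv -exprSr.
  split; first by rewrite -{2}(idu i) exprMn_comm // mulrA e1 -exprMn_comm // idu.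
  have cu' : GRing.comm u a by rewrite /GRing.comm cu.
  by rewrite -{2}(idu i) {2}cu exprMn_comm // -mulrA e2 -exprMn_comm // -cu idu.
move=> cx xx kx cy yy ly.
have [exy _] := core x y l cx xx cy ly; have [_ eyx] := core y x k cy yy cx kx.
have axy : a * x = a * y by rewrite exy -eyx.
by rewrite -xx -mulrA axy mulrA -cx axy cy yy.
Qed.

Lemma drazin_unique n (A X Y : 'M[C]_n) : is_drazin A X -> is_drazin A Y -> X = Y.
Proof.
move=> [cX X2 [k kX]] [cY Y2 [l lY]]; exact: (drazin_ring_unique cX X2 kX cY Y2 lY).
Qed.

Lemma unitary_diag_psd n (P : 'M[C]_n) (d : 'rV[C]_n) :
  (forall i, 0 <= d 0 i) -> psdmx (P^t* *m diag_mx d *m P).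
Proof.
move=> d_ge0; split.
  rewrite !trmxC_mul trmxCK mulmxA tr_diag_mx map_diag_mx; congr (_ *m diag_mx _ *m _).
  by apply/rowP => i; rewrite !mxE; apply/CrealP/ger0_real.
move=> x; rewrite !mulmxA -trmxC_mul -!mulmxA mulmxA mxE.
apply: sumr_ge0 => i _; rewrite mul_mx_diag !mxE mulrAC.
by apply: mulr_ge0 => //; rewrite mulrC mul_conjC_ge0.
Qed.

Lemma psdmx_diag n (M : 'M[C]_n) : psdmx M -> exists P : 'M[C]_n, exists d : 'rV[C]_n,
  [/\ P \is unitarymx, forall i, 0 <= d 0 i & M = P^t* *m diag_mx d *m P].
Proof.
move=> [hM pM].
have /orthomx_spectralP : M \is normalmx by apply/normalmxP; rewrite hM.
have uP := spectral_unitarymx M; move: (spectralmx M) (spectral_diag M) uP => P d uP.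
rewrite invmx_unitary // => defM; exists P, d; split=> // i.
have PP : P *m P^t* = 1%:M by apply/unitarymxP.
have := pM (P^t* *m delta_mx i 0).
rewrite {1}defM trmxC_mul trmxCK !mulmxA -(mulmxA _ P) PP mulmx1.
rewrite -(mulmxA _ P) PP mulmx1 trmx_delta map_delta_mx.
by rewrite -rowE -colE !mxE eqxx mulr1n.
Qed.

Lemma psd_sqrtP n (M : 'M[C]_n) : psdmx M ->
  psdmx (psd_sqrt M) /\ psd_sqrt M *m psd_sqrt M = M.
Proof.
move=> /psdmx_diag[P [d [/unitarymxP uP d_ge0 ->]]]; set M' := (X in psd_sqrt X).
apply: (@xgetPex _ _ [set S | psdmx S /\ S *m S = M']%classic).
exists (P^t* *m diag_mx (map_mx sqrtC d) *m P); split.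
  by apply: unitary_diag_psd => i; rewrite mxE sqrtC_ge0.
rewrite !mulmxA -(mulmxA _ P) uP mulmx1 -(mulmxA (P^t*)) mulmx_diag.
by congr (_ *m diag_mx _ *m _); apply/rowP => i; rewrite !mxE -expr2 sqrtCK.
Qed.

Lemma psd_sqrt_unique n (S T : 'M[C]_n) :
  psdmx S -> psdmx T -> S *m S = T *m T -> S = T.
Proof.
move=> /psdmx_diag[P [d [uP d_ge0 ->]]] /psdmx_diag[Q [e [uQ e_ge0 ->]]].
have /unitarymxP PP := uP; have /unitarymxP QQ := uQ.
have P'P : P^t* *m P = 1%:M by rewrite -invmx_unitary // mulVmx // unitarymx_unit.
have Q'Q : Q^t* *m Q = 1%:M by rewrite -invmx_unitary // mulVmx // unitarymx_unit.
rewrite !mulmxA -(mulmxA _ P) PP mulmx1 -(mulmxA _ Q) QQ mulmx1.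
rewrite -(mulmxA (P^t*)) mulmx_diag -(mulmxA (Q^t*)) mulmx_diag => eST.
have diag_sqrt (W : 'M[C]_n) :
    diag_mx (\row_i (d 0 i * d 0 i)) *m W = W *m diag_mx (\row_i (e 0 i * e 0 i)) ->
  diag_mx d *m W = W *m diag_mx e.
  move=> /matrixP dWe2; apply/matrixP => i j; have := dWe2 i j.
  rewrite !mul_diag_mx !mul_mx_diag !mxE => eij.
  have [->|w0] := eqVneq (W i j) 0; first by rewrite mulr0 mul0r.
  rewrite [RHS]mulrC; congr (_ * _); apply/eqP.
  rewrite -(@eqrXn2 _ 2) // !expr2; apply/eqP/(mulIf w0).
  by rewrite eij mulrC.
have dWe : diag_mx d *m (P *m Q^t*) = P *m Q^t* *m diag_mx e.
  apply: diag_sqrt; have := congr1 (fun X => P *m X *m Q^t*) eST.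
  by rewrite !mulmxA PP mul1mx -(mulmxA _ Q) QQ mulmx1.
have := congr1 (fun X => P^t* *m X *m Q) dWe.
rewrite !mulmxA -(mulmxA _ (Q^t*)) Q'Q mulmx1 => ->; congr (_ *m _).
by rewrite P'P mul1mx.
Qed.

Lemma gram_psd n (B : 'M[C]_n) : psdmx (B^t* *m B).
Proof.
split=> [|x]; first by rewrite trmxC_mul trmxCK.
by rewrite mulmxA -mulmxA -trmxC_mul; exact: sqnorm_ge0.
Qed.

Lemma absmxP n (B : 'M[C]_n) : psdmx (absmx B) /\ absmx B *m absmx B = B^t* *m B.
Proof. exact/psd_sqrtP/gram_psd. Qed.

Lemma absmx_add1_unit n (B : 'M[C]_n) : absmx B + 1%:M \in unitmx.
Proof.
have [[_ T_ge0] _] := absmxP B; apply: unitmx_col => x Tx; apply: sqnorm_eq0.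
have e : (x^t* *m absmx B *m x) 0 0 + (x^t* *m x) 0 0 = 0.
  have := congr1 (fun y => (x^t* *m y) 0 0) Tx.
  by rewrite mulmxDl mulmxDr mul1mx mulmxA mulmx0 [LHS]mxE [RHS]mxE.
by move/eqP: e; rewrite paddr_eq0 ?T_ge0 ?sqnorm_ge0 // => /andP[_ /eqP].
Qed.

End GeneralizedInverses.

Definition frobnorm (R : rcfType) m n (A : 'M[R[i]]_(m, n)) : R :=
  Num.sqrt (\sum_i \sum_j Normc.normc (A i j) ^+ 2).

(* Main.v *)
Require Import Defs.
From mathcomp Require Import all_boot all_order all_algebra.
From mathcomp Require Import all_classical all_reals.
From mathcomp Require Import complex.
From mathcomp Require Import ring.
Import Order.TTheory GRing.Theory Num.Theory.
Local Open Scope ring_scope.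

(** Write [Q = A A^d], [P = A A^+], [T = |Q^*|] and let [E = T T^+] be the
    orthogonal projection onto the range of [Q].  Since [Q T = T], [E Q = Q]
    and [P Q = Q], computing traces gives
    [|m(Q) - Q|^2 = |Q|^2 - tr T], [|T - E|^2 = |Q|^2 - 2 tr T + tr Q] and
    [|P - Q|^2 = tr P - 2 tr Q + |Q|^2], so that
    [2 (|m(Q) - Q|^2 + rank P - rank Q) - |P - Q|^2
       = |T - E|^2 + (rank P - rank Q)].
    The right-hand side is nonnegative, and it vanishes exactly when [T = E]
    and [rank P = rank Q], which forces [Q = E = P]. *)

Section MatchedProjection.
Set Implicit Arguments.
Unset Strict Implicit.
Local Open Scope sesquilinear_scope.
Variable C : numClosedFieldType.

(** * Conjugate transposes, Gram matrices and traces *)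

Lemma trmxCD m n (A B : 'M[C]_(m, n)) : (A + B)^t* = A^t* + B^t*.
Proof. by rewrite linearD map_mxD. Qed.

Lemma trmxCB m n (A B : 'M[C]_(m, n)) : (A - B)^t* = A^t* - B^t*.
Proof. by rewrite linearB map_mxB. Qed.

Lemma trmxC1 n : (1%:M : 'M[C]_n)^t* = 1%:M.
Proof. by rewrite trmx1 map_mx1. Qed.

Lemma mxtrace_trmxC n (B : 'M[C]_n) : \tr (B^t*) = (\tr B)^*.
Proof. by rewrite trace_map_mx mxtrace_tr. Qed.

Lemma mxtrace_gram m n (B : 'M[C]_(m, n)) :
  \tr (B *m B^t*) = \sum_i \sum_j `|B i j| ^+ 2.
Proof.
apply: eq_bigr => i _; rewrite mxE; apply: eq_bigr => j _.
by rewrite !mxE normCK.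
Qed.

Lemma mxtrace_gram_eq0 m n (B : 'M[C]_(m, n)) : \tr (B *m B^t*) = 0 -> B = 0.
Proof.
rewrite mxtrace_gram => /eqP; rewrite psumr_eq0 => [|i _]; last first.
  by apply: sumr_ge0 => j _; rewrite exprn_ge0.
move=> /allP B0; apply/matrixP => i j; rewrite mxE.
have := B0 i (mem_index_enum i); rewrite /= psumr_eq0 => [|k _]; last first.
  by rewrite exprn_ge0.
by move=> /allP/(_ j (mem_index_enum j)); rewrite /= expf_eq0 normr_eq0 => /eqP.
Qed.

Lemma mul_trmxC_eq0 m n (B : 'M[C]_(m, n)) : B *m B^t* = 0 -> B = 0.
Proof. by move=> B0; apply: mxtrace_gram_eq0; rewrite B0 mxtrace0. Qed.

(** Equal Gram matrices mean equal column spaces: the Gram matrix of [(X - 1) S] equals that of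
    [(X - 1) U = 0]. *)
Lemma fix_gram m n p (X : 'M[C]_m) (S : 'M[C]_(m, n)) (U : 'M[C]_(m, p)) :
  S *m S^t* = U *m U^t* -> X *m U = U -> X *m S = S.
Proof.
move=> SU XU; apply/subr0_eq; rewrite -{2}[S]mul1mx -mulmxBl.
apply: mul_trmxC_eq0; rewrite trmxC_mul -mulmxA (mulmxA S) SU !mulmxA.
by rewrite mulmxBl XU mul1mx subrr !mul0mx.
Qed.

(** In a full-rank factorization [Q = B D], cancelling [B] on the left and [D] on the right of
    [B D B D = B D] leaves [D B = 1], of size [\rank Q]; the trace is cyclic. *)
Lemma mxtrace_idem n (Q : 'M[C]_n) : Q *m Q = Q -> \tr Q = (\rank Q)%:R.
Proof.
move=> QQ; have := mulmx_base Q; have := row_base_free Q; have := col_base_full Q.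
move: (col_base Q) (row_base Q) => B D /row_fullP[L LB] freeD BD.
have DB : D *m B = 1%:M.
  apply: (row_free_inj freeD); rewrite /= mul1mx -[LHS]mul1mx -[RHS]mul1mx -LB.
  by rewrite -!mulmxA BD (mulmxA B) BD QQ.
by rewrite -{1}BD mxtrace_mulC DB mxtrace1.
Qed.

(** * Moore-Penrose inverses of Hermitian matrices *)

Lemma mpinv_herm n (T : 'M[C]_n) : T^t* = T -> (mpinv T)^t* = mpinv T.
Proof.
move=> hT; have [T1 T2 T3 T4] := mpinvP T.
have T3' : (mpinv T)^t* *m T = T *m mpinv T by rewrite -[RHS]T3 trmxC_mul hT.
have T4' : T *m (mpinv T)^t* = mpinv T *m T by rewrite -[RHS]T4 trmxC_mul hT.
apply: (@mpinv_unique _ _ _ T) => //; split.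
- by have := congr1 (fun X => X^t*) T1; rewrite !trmxC_mul hT mulmxA.
- by have := congr1 (fun X => X^t*) T2; rewrite !trmxC_mul hT mulmxA.
- by rewrite T4'.
- by rewrite T3'.
Qed.

Lemma mpinv_hermC n (T : 'M[C]_n) : T^t* = T -> T *m mpinv T = mpinv T *m T.
Proof.
move=> hT; have [_ _ T3 _] := mpinvP T.
by rewrite -T3 trmxC_mul hT mpinv_herm.
Qed.

Lemma mulmx_invC n (S U : 'M[C]_n) : U \in unitmx -> U *m S = S *m U ->
  invmx U *m S = S *m invmx U.
Proof.
by move=> uU cSU; rewrite -[LHS](mulmxK uU) -(mulmxA _ S) -cSU mulKmx.
Qed.

(** * The modulus [T] of [Q^t*] and its range projection [E] *)

Section Idempotent.
Variables (n : nat) (Q : 'M[C]_n).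
Hypothesis QQ : Q *m Q = Q.
Let T := absmx (Q^t*).
Let E := T *m mpinv T.

Lemma absC_herm : T^t* = T.
Proof. by have [[]] := absmxP (Q^t*). Qed.

Lemma absC_sqr : T *m T = Q *m Q^t*.
Proof. by have [_] := absmxP (Q^t*); rewrite trmxCK. Qed.

(** [T] and [Q] have the same Gram matrix, and [Q] fixes its own columns. *)
Lemma idem_absC : Q *m T = T.
Proof. by apply: fix_gram QQ; rewrite absC_herm absC_sqr. Qed.

Lemma absC_idem : T *m Q^t* = T.
Proof. by rewrite -{1}absC_herm -trmxC_mul idem_absC absC_herm. Qed.

Lemma rangeproj_herm : E^t* = E.
Proof. by have [] := mpinvP T. Qed.

Lemma rangeproj_absC : E *m T = T.
Proof. by have [] := mpinvP T. Qed.

Lemma rangeproj_idem : E *m E = E.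
Proof. by rewrite {2}/E mulmxA rangeproj_absC. Qed.

Lemma absC_rangeproj : T *m E = T.
Proof. by rewrite -{1}absC_herm -rangeproj_herm -trmxC_mul rangeproj_absC absC_herm. Qed.

Lemma rangeproj_mul : E *m Q = Q.
Proof. by apply: fix_gram rangeproj_absC; rewrite absC_herm absC_sqr. Qed.

Lemma mul_rangeproj : Q *m E = E.
Proof. by rewrite /E mulmxA idem_absC. Qed.

Lemma mxtrace_rangeproj : \tr E = \tr Q.
Proof. by rewrite -mul_rangeproj mxtrace_mulC rangeproj_mul. Qed.

(** * The matched projection: idempotency and traces *)

Let W := mpinv T *m invmx (T + 1%:M).

Lemma matched_projE : matched_proj Q = 2%:R^-1 *: ((T + Q^t*) *m W *m (T + Q)).
Proof. by rewrite /matched_proj /W !mulmxA. Qed.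

Let uT : T + 1%:M \in unitmx. Proof. exact: absmx_add1_unit. Qed.

Let WT1 : W *m (T + 1%:M) = mpinv T.
Proof. by rewrite /W mulmxKV. Qed.

Let WC : invmx (T + 1%:M) *m mpinv T = W.
Proof.
by apply: mulmx_invC => //; rewrite mulmxDl mulmxDr mul1mx mulmx1 (mpinv_hermC absC_herm).
Qed.

Let T1W : (T + 1%:M) *m W = mpinv T.
Proof. by rewrite -WC mulKVmx. Qed.

Let W_herm : W^t* = W.
Proof.
by rewrite trmxC_mul trmxC_inv trmxCD trmxC1 absC_herm mpinv_herm ?absC_herm.
Qed.

Lemma matched_proj_herm : (matched_proj Q)^t* = matched_proj Q.
Proof.
rewrite matched_projE; move: (W) W_herm => V hV.
rewrite linearZ map_mxZ !trmxC_mul hV !trmxCD trmxCK absC_herm mulmxA.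
by congr (_ *: _); rewrite /= rmorphV ?unitfE ?pnatr_eq0 // rmorph_nat.
Qed.

(** All four products are [T] or [T *m T]. The resulting factor 2 absorbs one of the scalars 1/2
    when [m(Q)] is squared. *)
Let middle : (T + Q) *m (T + Q^t*) = 2%:R *: (T *m (T + 1%:M)).
Proof.
rewrite mulmxDl !mulmxDr idem_absC absC_idem -absC_sqr mulmx1.
by rewrite scaler_nat mulr2n (addrC T).
Qed.

(** [W] is the Moore-Penrose inverse of [T (T + 1)], since functions of [T] commute; being an outer
    inverse is what makes [m(Q)] idempotent. *)
Let WTW : W *m (T *m (T + 1%:M)) *m W = W.
Proof.
have [_ N2 _ _] := mpinvP T.
rewrite -(mulmxA W) -(mulmxA T) T1W -{1}WC -(mulmxA _ (mpinv T)) (mulmxA (mpinv T)).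
by rewrite N2 WC.
Qed.

Lemma matched_proj_idem : matched_proj Q *m matched_proj Q = matched_proj Q.
Proof.
rewrite matched_projE; move: (W) WTW => V VTV.
rewrite -scalemxAl -scalemxAr; congr (_ *: _).
rewrite !mulmxA -(mulmxA _ (T + Q)) middle -!scalemxAr -!scalemxAl scalerA.
rewrite mulVf ?pnatr_eq0 // scale1r; congr (_ *m _).
by rewrite -(mulmxA (T + _)) -(mulmxA (T + _)) VTV.
Qed.

Lemma mxtrace_matched_proj : \tr (matched_proj Q) = \tr Q.
Proof.
rewrite matched_projE mxtraceZ mxtrace_mulC mulmxA middle -scalemxAl mxtraceZ mulrA.
by rewrite mulVf ?pnatr_eq0 // mul1r -mulmxA T1W mxtrace_rangeproj.
Qed.

Lemma mxtrace_matched_proj_mul : \tr (matched_proj Q *m Q) = 2%:R^-1 * (\tr Q + \tr T).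
Proof.
rewrite matched_projE -scalemxAl mxtraceZ -(mulmxA _ (T + Q)).
(* Idempotency of [Q] produces the factor [T + 1], which cancels the inverse inside [W] and leaves
   [mpinv T]. *)
have -> : (T + Q) *m Q = (T + 1%:M) *m Q by rewrite !mulmxDl QQ mul1mx.
rewrite mulmxA -(mulmxA _ W) WT1 -mulmxA mxtrace_mulC -mulmxA mulmxDr idem_absC.
rewrite -absC_sqr mulmxDr mxtraceD -(mpinv_hermC absC_herm) -/E mxtrace_rangeproj.
by rewrite mulmxA -(mpinv_hermC absC_herm) rangeproj_absC.
Qed.

(** * Squared Frobenius distances as traces *)

Lemma mxtrace_absC_conj : (\tr T)^* = \tr T.
Proof. by rewrite -mxtrace_trmxC absC_herm. Qed.

Lemma gram_matched_proj_sub (M := matched_proj Q) :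
  \tr ((M - Q) *m (M - Q)^t*) = \tr (Q *m Q^t*) - \tr T.
Proof.
have trMQ := mxtrace_matched_proj_mul; rewrite -/M in trMQ.
have rQ := mxtrace_idem QQ.
have trMQ' : \tr (M *m Q^t*) = 2%:R^-1 * (\tr Q + \tr T).
  (* Conjugation fixes both traces: [\tr Q] is a rank and [T] is Hermitian. *)
  rewrite -[M]matched_proj_herm -trmxC_mul mxtrace_trmxC mxtrace_mulC trMQ.
  rewrite rmorphM rmorphD /= mxtrace_absC_conj rQ.
  by rewrite rmorphV ?unitfE ?pnatr_eq0 // !rmorph_nat.
rewrite trmxCB matched_proj_herm -/M mulmxBl !mulmxBr !raddfB /=.
rewrite matched_proj_idem mxtrace_matched_proj (mxtrace_mulC Q M) trMQ trMQ'.
by field.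
Qed.

Lemma gram_absC_sub :
  \tr ((T - E) *m (T - E)^t*) = \tr (Q *m Q^t*) - 2%:R * \tr T + \tr Q.
Proof.
rewrite trmxCB absC_herm rangeproj_herm mulmxBl !mulmxBr !raddfB /=.
rewrite absC_rangeproj rangeproj_absC rangeproj_idem mxtrace_rangeproj absC_sqr.
by ring.
Qed.

Lemma gram_proj_sub (P : 'M[C]_n) : P^t* = P -> P *m P = P -> P *m Q = Q ->
  \tr ((P - Q) *m (P - Q)^t*) = \tr P - 2%:R * \tr Q + \tr (Q *m Q^t*).
Proof.
move=> hP PP PQ; rewrite trmxCB hP mulmxBl !mulmxBr !raddfB /= PP.
have -> : \tr (P *m Q^t*) = \tr Q.
  rewrite -[P]hP -trmxC_mul mxtrace_trmxC mxtrace_mulC PQ (mxtrace_idem QQ).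
  by rewrite rmorph_nat.
by rewrite (mxtrace_mulC Q P) PQ; ring.
Qed.

Lemma matched_proj_gap (P : 'M[C]_n) (M := matched_proj Q) :
    P^t* = P -> P *m P = P -> P *m Q = Q ->
  2%:R * (\tr ((M - Q) *m (M - Q)^t*) + (\rank P)%:R - (\rank Q)%:R) =
  \tr ((P - Q) *m (P - Q)^t*)
    + (\tr ((T - E) *m (T - E)^t*) + (\rank P)%:R - (\rank Q)%:R).
Proof.
move=> hP PP PQ; rewrite gram_matched_proj_sub gram_absC_sub gram_proj_sub //.
by rewrite -!mxtrace_idem //; ring.
Qed.

(** If [T = E] then [Q Q^* = T T = E], so [|E - Q|^2 = tr E - 2 tr Q + tr E], which is 0 because
    [tr E = tr Q]. *)
Lemma absC_eq_rangeproj : T = E -> E = Q.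
Proof.
move=> TE; apply/subr0_eq/mxtrace_gram_eq0.
rewrite gram_proj_sub ?rangeproj_herm ?rangeproj_idem ?rangeproj_mul //.
by rewrite -absC_sqr TE rangeproj_idem mxtrace_rangeproj; ring.
Qed.

(** A Hermitian idempotent is [Q^* Q], hence positive semi-definite and its own square root, so
    [T = Q]; the adjoint of [Q E = E] then gives [E = Q]. *)
Lemma herm_idem_rangeproj : Q^t* = Q -> T = E.
Proof.
move=> hQ; transitivity Q.
  apply: psd_sqrt_unique; last by rewrite absC_sqr hQ.
    by have [] := absmxP (Q^t*).
  by rewrite -{1}QQ -{1}hQ; apply: gram_psd.
have := congr1 (fun X => X^t*) mul_rangeproj.
by rewrite trmxC_mul hQ !rangeproj_herm rangeproj_mul.
Qed.

End Idempotent.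
End MatchedProjection.

(** * The real-valued Frobenius norm and the inequality *)

Section FrobeniusNorm.
Set Implicit Arguments.
Unset Strict Implicit.
Local Open Scope sesquilinear_scope.
Variable R : rcfType.

(** The right-hand side is the square root of [f ^+ 2 + d], so [d] alone measures the gap. *)
Lemma le_sqrt2_gap (f g d : R) :
    0 <= f -> 0 <= d -> 2%:R * g = f ^+ 2 + d ->
  f <= Num.sqrt 2%:R * Num.sqrt g /\ (f = Num.sqrt 2%:R * Num.sqrt g <-> d = 0).
Proof.
move=> f_ge0 d_ge0 fgd; rewrite -sqrtrM ?ler0n // fgd.
have fd_ge0 : 0 <= f ^+ 2 + d by rewrite addr_ge0 ?sqr_ge0.
split; first by rewrite -{1}[f]ger0_norm // -sqrtr_sqr ler_wsqrtr // lerDl.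
split=> [fE | ->]; last by rewrite addr0 sqrtr_sqr ger0_norm.
have := sqr_sqrtr fd_ge0; rewrite -fE => fd.
by rewrite -(addKr (f ^+ 2) d) -fd addNr.
Qed.

Lemma frobnorm_ge0 m n (B : 'M[R[i]]_(m, n)) : 0 <= frobnorm B.
Proof. exact: sqrtr_ge0. Qed.

Lemma frobnorm_gram m n (B : 'M[R[i]]_(m, n)) :
  real_complex R (frobnorm B ^+ 2) = \tr (B *m B^t*).
Proof.
rewrite mxtrace_gram sqr_sqrtr; last first.
  by apply: sumr_ge0 => i _; apply: sumr_ge0 => j _; apply: sqr_ge0.
rewrite rmorph_sum; apply: eq_bigr => i _; rewrite rmorph_sum.
by apply: eq_bigr => j _; rewrite rmorphXn.
Qed.

Lemma frobnorm_eq0 m n (B : 'M[R[i]]_(m, n)) : frobnorm B = 0 -> B = 0.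
Proof. by move=> B0; apply: mxtrace_gram_eq0; rewrite -frobnorm_gram B0 expr0n. Qed.

Lemma frobnorm0 m n : frobnorm (0 : 'M[R[i]]_(m, n)) = 0.
Proof.
rewrite /frobnorm big1 ?sqrtr0 // => i _; rewrite big1 // => j _.
by rewrite mxE Normc.normc0 expr0n.
Qed.

Lemma frobnorm_matched_proj_gap n (P Q : 'M[R[i]]_n)
    (T := absmx (Q^t*)) (d := frobnorm (T - T *m mpinv T) ^+ 2) :
    P^t* = P -> P *m P = P -> Q *m Q = Q -> P *m Q = Q ->
  2%:R * (frobnorm (matched_proj Q - Q) ^+ 2 + (\rank P)%:R - (\rank Q)%:R) =
    frobnorm (P - Q) ^+ 2 + (d + (\rank P)%:R - (\rank Q)%:R).
Proof.
(* The embedding of [R] into [R[i]] is injective, so the trace identity over [R[i]] descends to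
   [R]. *)
move=> hP PP QQ PQ; apply: (fmorph_inj (real_complex R)).
have := matched_proj_gap QQ hP PP PQ; rewrite -!frobnorm_gram -/d.
move: (_ ^+ 2) (_ ^+ 2) d => x y z gap.
by rewrite !(rmorphM, rmorphD, rmorphN) !rmorph_nat.
Qed.

(** Here [P] is any orthogonal projection whose range contains that of [Q]; the theorem takes
    [P = A A^+] and [Q = A A^d]. *)
Lemma frobnorm_matched_proj n (P Q : 'M[R[i]]_n) (lhs := frobnorm (P - Q))
    (rhs := Num.sqrt 2%:R * Num.sqrt
      (frobnorm (matched_proj Q - Q) ^+ 2 + (\rank P)%:R - (\rank Q)%:R)) :
    P^t* = P -> P *m P = P -> Q *m Q = Q -> P *m Q = Q ->
  lhs <= rhs /\ (lhs = rhs <-> P = Q).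
Proof.
move=> hP PP QQ PQ; have rQP : (\rank Q <= \rank P)%N by rewrite -PQ mxrankM_maxl.
have gap := frobnorm_matched_proj_gap hP PP QQ PQ.
set d := (X in _ + (X + _ - _)) in gap.
have [d_ge0 r_ge0] : 0 <= d /\ 0 <= (\rank P)%:R - (\rank Q)%:R :> R.
  by rewrite sqr_ge0 subr_ge0 ler_nat.
have [le_lr eq_lr] : lhs <= rhs /\ (lhs = rhs <-> d + (\rank P)%:R - (\rank Q)%:R = 0).
  by apply: le_sqrt2_gap gap; rewrite ?frobnorm_ge0 // -addrA addr_ge0.
split=> //; rewrite eq_lr; split=> [|PQ_eq]; last first.
  have hQ : Q^t* = Q by rewrite -PQ_eq.
  rewrite -addrA PQ_eq subrr addr0 /d -(herm_idem_rangeproj QQ hQ) subrr.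
  by rewrite frobnorm0 expr0n.
rewrite -addrA => /eqP; rewrite paddr_eq0 // => /andP[].
rewrite sqrf_eq0 => /eqP/frobnorm_eq0/subr0_eq TE /eqP/subr0_eq rPQ.
have EQ := absC_eq_rangeproj QQ TE; have hQ : Q^t* = Q by rewrite -EQ rangeproj_herm.
(* The rank equality moves from [R] to [R[i]], where the traces live. *)
have {}rPQ : (\rank P)%:R = (\rank Q)%:R :> R[i].
  by apply/eqP; move/eqP: rPQ; rewrite !eqr_nat.
(* Now [Q] is a projection too, so [|P - Q|^2] collapses to [rank P - rank Q]. *)
apply/subr0_eq/mxtrace_gram_eq0; rewrite (gram_proj_sub QQ hP PP PQ) hQ QQ.
by rewrite !mxtrace_idem // rPQ; ring.
Qed.

End FrobeniusNorm.

(** * Specialization to the projections of [A] *)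

Theorem corollary5p7 (R : realType) (n : nat) (n_gt0 : (0 < n)%N)
    (A : 'M[R[i]]_n) :
  let lhs := frobnorm (A *m mpinv A - A *m drazin A) in
  let rhs := Num.sqrt 2%:R *
    Num.sqrt (frobnorm (matched_proj (A *m drazin A) - A *m drazin A) ^+ 2
              + (\rank A)%:R - (\rank (drazin A))%:R) in
  lhs <= rhs /\ (lhs = rhs <-> drazin A = mpinv A).
Proof.
have [N1 N2 N3 N4] := mpinvP A; have [D1 D2 _] := drazinP A.
move: (mpinv A) (drazin A) N1 N2 N3 N4 D1 D2 => X D AXA XAX hAX hXA AD_DA DAD lhs rhs.
have rAX : \rank (A *m X) = \rank A.
  by apply/eqP; rewrite eqn_leq mxrankM_maxl -{1}AXA mxrankM_maxl.
have rAD : \rank (A *m D) = \rank D.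
  by apply/eqP; rewrite eqn_leq mxrankM_maxr AD_DA -{1}DAD mxrankM_maxl.
have [|||le_lr eq_lr] := @frobnorm_matched_proj R n (A *m X) (A *m D) hAX.
- by rewrite mulmxA AXA.
- by rewrite -mulmxA (mulmxA D) DAD.
- by rewrite mulmxA AXA.
rewrite rAX rAD in le_lr eq_lr; split=> //; rewrite eq_lr; split=> [PQ|->] //.
(* From [A X = A D = D A], the Drazin inverse [D] inherits the Penrose equations:
   [A D A = A X A = A], and [A D] and [D A] are Hermitian like [A X]. *)
apply: (@mpinv_unique _ _ _ A) => //; split=> //; rewrite -?AD_DA -?PQ //.
Qed.
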